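(* Let $1\le n\le N-1$ and let $\mathbf E^n,\mathbf H^n$ be the solution of the ADI-FDTD scheme with the discrete PEC boundary condition (both defined in the context). Then for each $w\in\{x,y,z\}$, with $L(x)=I$, $L(y)=J$, $L(z)=K$, $$\begin{aligned} &\|\delta_w\delta_t\mathbf E^{n+\frac12}\|_E^2+\|\delta_w\delta_t\mathbf H^{n+\frac12}\|_H^2+\frac{(\Delta t)^2}{4\mu\varepsilon}\Big(\|\delta_w\delta_1^h\delta_t\mathbf E^{n+\frac12}\|_H^2+\|\delta_w\delta_2^h\delta_t\mathbf H^{n+\frac12}\|_E^2\Big)\\ &\quad+\|\delta_t\mathbf E^{n+\frac12}\|_{L(w)}^2+\|\delta_t\mathbf H^{n+\frac12}\|_{L(w)}^2+\frac{(\Delta t)^2}{4\mu\varepsilon}\Big(\|\delta_2^h\delta_t\mathbf H^{n+\frac12}\|_{L(w)}^2+\|\delta_1^h\delta_t\mathbf E^{n+\frac12}\|_{L(w)}^2\Big)\\ &=\|\delta_w\delta_t\mathbf E^{n-\frac12}\|_E^2+\|\delta_w\delta_t\mathbf H^{n-\frac12}\|_H^2+\frac{(\Delta t)^2}{4\mu\varepsilon}\Big(\|\delta_w\delta_1^h\delta_t\mathbf E^{n-\frac12}\|_H^2+\|\delta_w\delta_2^h\delta_t\mathbf H^{n-\frac12}\|_E^2\Big)\\ &\quad+\|\delta_t\mathbf E^{n-\frac12}\|_{L(w)}^2+\|\delta_t\mathbf H^{n-\frac12}\|_{L(w)}^2+\frac{(\Delta t)^2}{4\mu\varepsilon}\Big(\|\delta_2^h\delta_t\mathbf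 H^{n-\frac12}\|_{L(w)}^2+\|\delta_1^h\delta_t\mathbf E^{n-\frac12}\|_{L(w)}^2\Big). \end{aligned}$$
   Context: **Grid.** $\varepsilon,\mu>0$ are constants; $I,J,K\ge2$ and $N\ge1$ are integers; $\Delta x=1/I$, $\Delta y=1/J$, $\Delta z=1/K$, $T>0$, $\Delta t=T/N$; $\Delta v=\Delta x\Delta y\Delta z$; $\bar l:=l+\tfrac12$ for $l=i,j,k,n$. A grid function carries spatial indices $(\alpha,\beta,\gamma)$ (integers or half-integers), referring to the point $(\alpha\Delta x,\beta\Delta y,\gamma\Delta z)$ of the unit cube, and a time index $m$ for time $m\Delta t$. ''$F|_{\alpha,\beta,\gamma}$'' means that all terms of $F$ are evaluated at spatial index $(\alpha,\beta,\gamma)$. The components live on staggered grids: $E_x$ at $(\bar i,j,k)$, $E_y$ at $(i,\bar j,k)$, $E_z$ at $(i,j,\bar k)$ (E-points); $H_x$ at $(i,\bar j,\bar k)$, $H_y$ at $(\bar i,j,\bar k)$, $H_z$ at $(\bar i,\bar j,k)$ (H-points). Here an integer $x$-index runs over $0,\dots,I$ and a half-integer one over $\tfrac12,\dots,I-\tfrac12$, similarly for $y$ (with $J$) and $z$ (with $K$). **Difference operators.** $\delta_xU_{\alpha,\beta,\gamma}=(U_{\alpha+\frac12,\beta,\gamma}-U_{\alpha-\frac12,\beta,\gamma})/\Delta x$, and $\delta_y,\delta_z$ analogously; $\delta_tU^{m}=(U^{m+\frac12}-U^{m-\frac12})/\Delta t$, so $\delta_t\mathbf E^{n+\frac12}=(\mathbf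 E^{n+1}-\mathbf E^n)/\Delta t$. For vector grid functions $\delta_w\mathbf U=(\delta_wU_x,\delta_wU_y,\delta_wU_z)$, $\delta_1^h\mathbf U=(\delta_yU_z,\delta_zU_x,\delta_xU_y)$, $\delta_2^h\mathbf U=(\delta_zU_y,\delta_xU_z,\delta_yU_x)$. Thus the components of $\delta_1^h\mathbf E$ live at H-points and those of $\delta_2^h\mathbf H$ at (interior) E-points. **ADI-FDTD scheme.** Given $\mathbf E^n,\mathbf H^n$, the fields $\mathbf E^{\bar n},\mathbf H^{\bar n}$ and $\mathbf E^{n+1},\mathbf H^{n+1}$ satisfy, for every $0\le n\le N-1$: Stage 1: $\frac{E_x^{\bar n}-E_x^n}{\Delta t}=\frac1{2\varepsilon}(\delta_yH_z^{\bar n}-\delta_zH_y^n)|_{\bar i,j,k}$, $\frac{E_y^{\bar n}-E_y^n}{\Delta t}=\frac1{2\varepsilon}(\delta_zH_x^{\bar n}-\delta_xH_z^n)|_{i,\bar j,k}$, $\frac{E_z^{\bar n}-E_z^n}{\Delta t}=\frac1{2\varepsilon}(\delta_xH_y^{\bar n}-\delta_yH_x^n)|_{i,j,\bar k}$, $\frac{H_x^{\bar n}-H_x^n}{\Delta t}=\frac1{2\mu}(\delta_zE_y^{\bar n}-\delta_yE_z^n)|_{i,\bar j,\bar k}$, $\frac{H_y^{\bar n}-H_y^n}{\Delta t}=\frac1{2\mu}(\delta_xE_z^{\bar n}-\delta_zE_x^n)|_{\bar i,j,\bar k}$, $\frac{H_z^{\bar n}-H_z^n}{\Delta t}=\frac1{2\mu}(\delta_yE_x^{\bar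 n}-\delta_xE_y^n)|_{\bar i,\bar j,k}$. Stage 2: $\frac{E_x^{n+1}-E_x^{\bar n}}{\Delta t}=\frac1{2\varepsilon}(\delta_yH_z^{\bar n}-\delta_zH_y^{n+1})|_{\bar i,j,k}$, $\frac{E_y^{n+1}-E_y^{\bar n}}{\Delta t}=\frac1{2\varepsilon}(\delta_zH_x^{\bar n}-\delta_xH_z^{n+1})|_{i,\bar j,k}$, $\frac{E_z^{n+1}-E_z^{\bar n}}{\Delta t}=\frac1{2\varepsilon}(\delta_xH_y^{\bar n}-\delta_yH_x^{n+1})|_{i,j,\bar k}$, $\frac{H_x^{n+1}-H_x^{\bar n}}{\Delta t}=\frac1{2\mu}(\delta_zE_y^{\bar n}-\delta_yE_z^{n+1})|_{i,\bar j,\bar k}$, $\frac{H_y^{n+1}-H_y^{\bar n}}{\Delta t}=\frac1{2\mu}(\delta_xE_z^{\bar n}-\delta_zE_x^{n+1})|_{\bar i,j,\bar k}$, $\frac{H_z^{n+1}-H_z^{\bar n}}{\Delta t}=\frac1{2\mu}(\delta_yE_x^{\bar n}-\delta_xE_y^{n+1})|_{\bar i,\bar j,k}$. The $\mathbf E$-equations hold at the E-points not lying on a face where that component is tangential (i.e. its integer indices are strictly between the endpoints); the $\mathbf H$-equations hold at all H-points. *Discrete PEC boundary condition*, for all integer and half-integer time levels $m$: $E_x^m=0$ if its $y$-index is $0$ or $J$ or its $z$-index is $0$ or $K$; $E_y^m=0$ if its $x$-index is $0$ or $I$ or its $z$-index is $0$ or $K$; $E_z^m=0$ if its $x$-index is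 $0$ or $I$ or its $y$-index is $0$ or $J$. **Norms.** The weight $P(\cdot)$ equals $\varepsilon$ for grid functions obtained from the electric field (e.g. $\mathbf E$, $\delta_t\mathbf E$, $\delta_1^h\delta_t\mathbf E$) and $\mu$ for those obtained from the magnetic field (e.g. $\mathbf H$, $\delta_2^h\delta_t\mathbf H$). For $\mathbf U$ on E-points and $\mathbf V$ on H-points, $$\|\mathbf U\|_E^2=\Delta v\,P(\mathbf U)\Big[\sum_{i=0}^{I-1}\sum_{j=1}^{J-1}\sum_{k=1}^{K-1}U_x^2|_{\bar i,j,k}+\sum_{i=1}^{I-1}\sum_{j=0}^{J-1}\sum_{k=1}^{K-1}U_y^2|_{i,\bar j,k}+\sum_{i=1}^{I-1}\sum_{j=1}^{J-1}\sum_{k=0}^{K-1}U_z^2|_{i,j,\bar k}\Big],$$ $$\|\mathbf V\|_H^2=\Delta v\,P(\mathbf V)\Big[\sum_{i=0}^{I}\sum_{j=0}^{J-1}\sum_{k=0}^{K-1}V_x^2|_{i,\bar j,\bar k}+\sum_{i=0}^{I-1}\sum_{j=0}^{J}\sum_{k=0}^{K-1}V_y^2|_{\bar i,j,\bar k}+\sum_{i=0}^{I-1}\sum_{j=0}^{J-1}\sum_{k=0}^{K}V_z^2|_{\bar i,\bar j,k}\Big].$$ $\|\delta_w\mathbf U\|_E$ and $\|\delta_w\mathbf V\|_H$ are given by the same formulas with each component replaced by its $\delta_w$-difference, the ranges in the two directions other than $w$ being unchanged, while in direction $w$ (with $L=I,J,K$ for $w=x,y,z$): if the undifferenced component has integer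 $w$-index, its difference is summed over $w$-indices $\ell+\frac12$, $1\le\ell\le L-2$; if it has half-integer $w$-index, its difference is summed over integer $w$-indices $1\le\ell\le L-1$. Near-boundary norms: for $\mathbf U$ on E-points and $\mathbf V$ on H-points, $$\|\mathbf U\|_I^2=\frac{\Delta y\Delta z}{\Delta x}P(\mathbf U)\sum_{i'=1,\,I-1}\Big[\sum_{j=0}^{J-1}\sum_{k=1}^{K-1}U_y^2|_{i',\bar j,k}+\sum_{j=1}^{J-1}\sum_{k=0}^{K-1}U_z^2|_{i',j,\bar k}\Big],$$ $$\|\mathbf V\|_I^2=\frac{\Delta y\Delta z}{\Delta x}P(\mathbf V)\sum_{j=0}^{J-1}\sum_{k=0}^{K-1}\Big[V_x^2|_{1,\bar j,\bar k}+V_x^2|_{I-1,\bar j,\bar k}\Big]$$ ($\sum_{i'=1,I-1}$ is a sum of two terms, even if $I=2$). $\|\cdot\|_J$ and $\|\cdot\|_K$ are the analogues in the $y$- and $z$-directions: $\|\mathbf U\|_J$ uses $U_x,U_z$ at $y$-index $1,J-1$, $\|\mathbf V\|_J$ uses $V_y$ at $y$-index $1,J-1$ (factor $\Delta x\Delta z/\Delta y$); $\|\mathbf U\|_K$ uses $U_x,U_y$ at $z$-index $1,K-1$, $\|\mathbf V\|_K$ uses $V_z$ at $z$-index $1,K-1$ (factor $\Delta x\Delta y/\Delta z$), the remaining indices ranging as in $\|\cdot\|_E$, $\|\cdot\|_H$. *)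

(* Defs.v *)
From HB Require Import structures.
From mathcomp Require Import all_boot all_order all_algebra.

Set Implicit Arguments.
Unset Strict Implicit.
Unset Printing Implicit Defensive.

Import Order.TTheory GRing.Theory Num.Theory.
Local Open Scope ring_scope.

(* Integer and half-integer indices, in space and in time, are stored doubled:
   the integer a : int stands for the index a / 2.  A shift of an index by 1/2
   is thus a shift of its code by 1. *)
Definition node (l : nat) : int := (l.*2)%:Z.
Definition mid (l : nat) : int := (l.*2.+1)%:Z.

Variant dir := dx | dy | dz.

Definition scalar_grid_fun (R : Type) := int -> int -> int -> R.

(* Grid functions are total; only values at actual grid points are ever
   constrained by [adi_fdtd] and [pec] or used in the norms. *)
Definition vector_grid_fun (R : Type) := dir -> scalar_grid_fun R.

(* The first argument is the doubled time index. *)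
Definition evolution (R : Type) := int -> vector_grid_fun R.

Record mesh := Mesh { Nx : nat; Ny : nat; Nz : nat }.

Definition ncells (g : mesh) (w : dir) : nat :=
  match w with dx => Nx g | dy => Ny g | dz => Nz g end.

Definition step (R : realFieldType) (g : mesh) (w : dir) : R :=
  1 / (ncells g w)%:R.

Definition cell_volume (R : realFieldType) (g : mesh) : R :=
  step R g dx * step R g dy * step R g dz.

Definition delta (R : realFieldType) (g : mesh) (w : dir)
    (U : scalar_grid_fun R) : scalar_grid_fun R :=
  fun a b c =>
    match w with
    | dx => (U (a + 1) b c - U (a - 1) b c) / step R g dx
    | dy => (U a (b + 1) c - U a (b - 1) c) / step R g dy
    | dz => (U a b (c + 1) - U a b (c - 1)) / step R g dz
    end.

Definition vdelta (R : realFieldType) (g : mesh) (w : dir)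
    (U : vector_grid_fun R) : vector_grid_fun R :=
  fun d => delta g w (U d).

Definition delta1h (R : realFieldType) (g : mesh) (U : vector_grid_fun R) :
    vector_grid_fun R :=
  fun d => match d with
           | dx => delta g dy (U dz)
           | dy => delta g dz (U dx)
           | dz => delta g dx (U dy)
           end.

Definition delta2h (R : realFieldType) (g : mesh) (U : vector_grid_fun R) :
    vector_grid_fun R :=
  fun d => match d with
           | dx => delta g dz (U dy)
           | dy => delta g dx (U dz)
           | dz => delta g dy (U dx)
           end.

Definition delta_t (R : realFieldType) (dt : R) (U : evolution R) :
    evolution R :=
  fun m d a b c => (U (m + 1) d a b c - U (m - 1) d a b c) / dt.

Definition adi_stage1 (R : realFieldType) (g : mesh) (eps mu dt : R)
    (E H : evolution R) (n : nat) : Prop :=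
  let E0 := E (node n) in let H0 := H (node n) in
  let E1 := E (mid n) in let H1 := H (mid n) in
  [/\ forall i j k : nat, (i < Nx g)%N -> (0 < j < Ny g)%N -> (0 < k < Nz g)%N ->
        let a := mid i in let b := node j in let c := node k in
        (E1 dx a b c - E0 dx a b c) / dt
        = 1 / (2 * eps) * (delta g dy (H1 dz) a b c - delta g dz (H0 dy) a b c),
      forall i j k : nat, (0 < i < Nx g)%N -> (j < Ny g)%N -> (0 < k < Nz g)%N ->
        let a := node i in let b := mid j in let c := node k in
        (E1 dy a b c - E0 dy a b c) / dt
        = 1 / (2 * eps) * (delta g dz (H1 dx) a b c - delta g dx (H0 dz) a b c)
    & forall i j k : nat, (0 < i < Nx g)%N -> (0 < j < Ny g)%N -> (k < Nz g)%N ->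
        let a := node i in let b := node j in let c := mid k in
        (E1 dz a b c - E0 dz a b c) / dt
        = 1 / (2 * eps) * (delta g dx (H1 dy) a b c - delta g dy (H0 dx) a b c)]
  /\
  [/\ forall i j k : nat, (i <= Nx g)%N -> (j < Ny g)%N -> (k < Nz g)%N ->
        let a := node i in let b := mid j in let c := mid k in
        (H1 dx a b c - H0 dx a b c) / dt
        = 1 / (2 * mu) * (delta g dz (E1 dy) a b c - delta g dy (E0 dz) a b c),
      forall i j k : nat, (i < Nx g)%N -> (j <= Ny g)%N -> (k < Nz g)%N ->
        let a := mid i in let b := node j in let c := mid k in
        (H1 dy a b c - H0 dy a b c) / dt
        = 1 / (2 * mu) * (delta g dx (E1 dz) a b c - delta g dz (E0 dx) a b c)
    & forall i j k : nat, (i < Nx g)%N -> (j < Ny g)%N -> (k <= Nz g)%N ->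
        let a := mid i in let b := mid j in let c := node k in
        (H1 dz a b c - H0 dz a b c) / dt
        = 1 / (2 * mu) * (delta g dy (E1 dx) a b c - delta g dx (E0 dy) a b c)].

Definition adi_stage2 (R : realFieldType) (g : mesh) (eps mu dt : R)
    (E H : evolution R) (n : nat) : Prop :=
  let E1 := E (mid n) in let H1 := H (mid n) in
  let E2 := E (node n.+1) in let H2 := H (node n.+1) in
  [/\ forall i j k : nat, (i < Nx g)%N -> (0 < j < Ny g)%N -> (0 < k < Nz g)%N ->
        let a := mid i in let b := node j in let c := node k in
        (E2 dx a b c - E1 dx a b c) / dt
        = 1 / (2 * eps) * (delta g dy (H1 dz) a b c - delta g dz (H2 dy) a b c),
      forall i j k : nat, (0 < i < Nx g)%N -> (j < Ny g)%N -> (0 < k < Nz g)%N ->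
        let a := node i in let b := mid j in let c := node k in
        (E2 dy a b c - E1 dy a b c) / dt
        = 1 / (2 * eps) * (delta g dz (H1 dx) a b c - delta g dx (H2 dz) a b c)
    & forall i j k : nat, (0 < i < Nx g)%N -> (0 < j < Ny g)%N -> (k < Nz g)%N ->
        let a := node i in let b := node j in let c := mid k in
        (E2 dz a b c - E1 dz a b c) / dt
        = 1 / (2 * eps) * (delta g dx (H1 dy) a b c - delta g dy (H2 dx) a b c)]
  /\
  [/\ forall i j k : nat, (i <= Nx g)%N -> (j < Ny g)%N -> (k < Nz g)%N ->
        let a := node i in let b := mid j in let c := mid k in
        (H2 dx a b c - H1 dx a b c) / dt
        = 1 / (2 * mu) * (delta g dz (E1 dy) a b c - delta g dy (E2 dz) a b c),
      forall i j k : nat, (i < Nx g)%N -> (j <= Ny g)%N -> (k < Nz g)%N ->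
        let a := mid i in let b := node j in let c := mid k in
        (H2 dy a b c - H1 dy a b c) / dt
        = 1 / (2 * mu) * (delta g dx (E1 dz) a b c - delta g dz (E2 dx) a b c)
    & forall i j k : nat, (i < Nx g)%N -> (j < Ny g)%N -> (k <= Nz g)%N ->
        let a := mid i in let b := mid j in let c := node k in
        (H2 dz a b c - H1 dz a b c) / dt
        = 1 / (2 * mu) * (delta g dy (E1 dx) a b c - delta g dx (E2 dy) a b c)].

Definition adi_fdtd (R : realFieldType) (g : mesh) (eps mu dt : R) (N : nat)
    (E H : evolution R) : Prop :=
  forall n : nat, (n < N)%N ->
    adi_stage1 g eps mu dt E H n /\ adi_stage2 g eps mu dt E H n.

Definition pec_at (R : realFieldType) (g : mesh) (U : vector_grid_fun R) : Prop :=
  [/\ forall i j k : nat, (i < Nx g)%N -> (j <= Ny g)%N -> (k <= Nz g)%N ->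
        [\/ j = 0%N, j = Ny g, k = 0%N | k = Nz g] ->
        U dx (mid i) (node j) (node k) = 0,
      forall i j k : nat, (i <= Nx g)%N -> (j < Ny g)%N -> (k <= Nz g)%N ->
        [\/ i = 0%N, i = Nx g, k = 0%N | k = Nz g] ->
        U dy (node i) (mid j) (node k) = 0
    & forall i j k : nat, (i <= Nx g)%N -> (j <= Ny g)%N -> (k < Nz g)%N ->
        [\/ i = 0%N, i = Nx g, j = 0%N | j = Ny g] ->
        U dz (node i) (node j) (mid k) = 0].

(* The natural number m is a doubled time index: levels 0, 1/2, 1, ..., N. *)
Definition pec (R : realFieldType) (g : mesh) (N : nat) (E : evolution R) : Prop :=
  forall m : nat, (m <= N.*2)%N -> pec_at g (E m%:Z).

(* [nodes l1 l2] lists the indices l and [mids l1 l2] the indices l + 1/2,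
   both for l1 <= l < l2. *)
Definition nodes (l1 l2 : nat) : seq int := [seq node l | l <- index_iota l1 l2].
Definition mids (l1 l2 : nat) : seq int := [seq mid l | l <- index_iota l1 l2].

(* A list and not a set: for L = 2 the layer 1 is counted twice. *)
Definition near_boundary (L : nat) : seq int := [:: node 1; node L.-1].

Definition sumsq (R : realFieldType) (rx ry rz : seq int)
    (U : scalar_grid_fun R) : R :=
  \sum_(a <- rx) \sum_(b <- ry) \sum_(c <- rz) U a b c ^+ 2.

(* Squared norms.  P is the material weight: eps for grid functions obtained
   from the electric field, mu for those obtained from the magnetic field. *)

Definition normE2 (R : realFieldType) (g : mesh) (P : R)
    (U : vector_grid_fun R) : R :=
  let (I, J, K) := g in
  cell_volume R g * P *
  (sumsq (mids 0 I) (nodes 1 J) (nodes 1 K) (U dx)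
   + sumsq (nodes 1 I) (mids 0 J) (nodes 1 K) (U dy)
   + sumsq (nodes 1 I) (nodes 1 J) (mids 0 K) (U dz)).

Definition normH2 (R : realFieldType) (g : mesh) (P : R)
    (V : vector_grid_fun R) : R :=
  let (I, J, K) := g in
  cell_volume R g * P *
  (sumsq (nodes 0 I.+1) (mids 0 J) (mids 0 K) (V dx)
   + sumsq (mids 0 I) (nodes 0 J.+1) (mids 0 K) (V dy)
   + sumsq (mids 0 I) (mids 0 J) (nodes 0 K.+1) (V dz)).

(* [normE2_delta g w P U] is ||delta_w U||_E^2 and [normH2_delta g w P V] is
   ||delta_w V||_H^2.  They differ from [normE2] and [normH2] applied to the
   differenced function by the ranges in direction w. *)

Definition normE2_delta (R : realFieldType) (g : mesh) (w : dir) (P : R)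
    (U : vector_grid_fun R) : R :=
  let (I, J, K) := g in
  let D := vdelta g w U in
  cell_volume R g * P *
  match w with
  | dx => sumsq (nodes 1 I) (nodes 1 J) (nodes 1 K) (D dx)
          + sumsq (mids 1 I.-1) (mids 0 J) (nodes 1 K) (D dy)
          + sumsq (mids 1 I.-1) (nodes 1 J) (mids 0 K) (D dz)
  | dy => sumsq (mids 0 I) (mids 1 J.-1) (nodes 1 K) (D dx)
          + sumsq (nodes 1 I) (nodes 1 J) (nodes 1 K) (D dy)
          + sumsq (nodes 1 I) (mids 1 J.-1) (mids 0 K) (D dz)
  | dz => sumsq (mids 0 I) (nodes 1 J) (mids 1 K.-1) (D dx)
          + sumsq (nodes 1 I) (mids 0 J) (mids 1 K.-1) (D dy)
          + sumsq (nodes 1 I) (nodes 1 J) (nodes 1 K) (D dz)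
  end.

Definition normH2_delta (R : realFieldType) (g : mesh) (w : dir) (P : R)
    (V : vector_grid_fun R) : R :=
  let (I, J, K) := g in
  let D := vdelta g w V in
  cell_volume R g * P *
  match w with
  | dx => sumsq (mids 1 I.-1) (mids 0 J) (mids 0 K) (D dx)
          + sumsq (nodes 1 I) (nodes 0 J.+1) (mids 0 K) (D dy)
          + sumsq (nodes 1 I) (mids 0 J) (nodes 0 K.+1) (D dz)
  | dy => sumsq (nodes 0 I.+1) (nodes 1 J) (mids 0 K) (D dx)
          + sumsq (mids 0 I) (mids 1 J.-1) (mids 0 K) (D dy)
          + sumsq (mids 0 I) (nodes 1 J) (nodes 0 K.+1) (D dz)
  | dz => sumsq (nodes 0 I.+1) (mids 0 J) (nodes 1 K) (D dx)
          + sumsq (mids 0 I) (nodes 0 J.+1) (nodes 1 K) (D dy)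
          + sumsq (mids 0 I) (mids 0 J) (mids 1 K.-1) (D dz)
  end.

(* Squared near-boundary norms ||.||_L(w)^2, for functions on E-points and on
   H-points respectively. *)

Definition normLE2 (R : realFieldType) (g : mesh) (w : dir) (P : R)
    (U : vector_grid_fun R) : R :=
  let (I, J, K) := g in
  let hx := step R g dx in let hy := step R g dy in let hz := step R g dz in
  match w with
  | dx => hy * hz / hx * P *
          (sumsq (near_boundary I) (mids 0 J) (nodes 1 K) (U dy)
           + sumsq (near_boundary I) (nodes 1 J) (mids 0 K) (U dz))
  | dy => hx * hz / hy * P *
          (sumsq (mids 0 I) (near_boundary J) (nodes 1 K) (U dx)
           + sumsq (nodes 1 I) (near_boundary J) (mids 0 K) (U dz))
  | dz => hx * hy / hz * P *
          (sumsq (mids 0 I) (nodes 1 J) (near_boundary K) (U dx)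
           + sumsq (nodes 1 I) (mids 0 J) (near_boundary K) (U dy))
  end.

Definition normLH2 (R : realFieldType) (g : mesh) (w : dir) (P : R)
    (V : vector_grid_fun R) : R :=
  let (I, J, K) := g in
  let hx := step R g dx in let hy := step R g dy in let hz := step R g dz in
  match w with
  | dx => hy * hz / hx * P *
          sumsq (near_boundary I) (mids 0 J) (mids 0 K) (V dx)
  | dy => hx * hz / hy * P *
          sumsq (mids 0 I) (near_boundary J) (mids 0 K) (V dy)
  | dz => hx * hy / hz * P *
          sumsq (mids 0 I) (mids 0 J) (near_boundary K) (V dz)
  end.

(* Main.v *)
Require Import Defs.
From HB Require Import structures.
From mathcomp Require Import all_boot all_order all_algebra.
From mathcomp Require Import ring lra zify.

Set Implicit Arguments.
Unset Strict Implicit.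
Unset Printing Implicit Defensive.

Import Order.TTheory GRing.Theory Num.Theory.
Local Open Scope ring_scope.

(** The theorem is an energy identity, of the kind that holds for the scheme
itself, applied to the discrete derivative delta_w delta_t (E, H).

With a = dt / (2 eps) and b = dt / (2 mu), the first stage reads
    e1 - a delta1h h1 = e0 - a delta2h h0,
    h1 - b delta2h e1 = h0 - b delta1h e0.
Square both sides of both lines, sum the first over the electric grid with
weight eps and the second over the magnetic grid with weight mu, and add.
Since eps a = mu b, the mixed products appear as
    <e1, delta1h h1> + <h1, delta2h e1>   and   <e0, delta2h h0> + <h0, delta1h e0>,
which are zero by summation by parts ([delta0_skew]): boundary terms carry
values on the walls of the cube, where the fields vanish.  What is left is a
sum of squared norms at either end of the stage ([half_step0_energy]).  The
second stage is the first one run backwards in time with a and b replaced by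
their opposites; a and b enter the energy squared, so two stages together
preserve the energy.

Two points make this work for delta_w delta_t (E, H).

- Boundary values.  The electric field vanishes on the walls where it is
tangential.  The normal magnetic field on a wall need not vanish, but its
equations there only involve tangential electric values, so that it is constant
in time ([half_step_wall]) and its time difference does vanish.

- Differencing in direction w exchanges integer and half-integer w-indices, and
needs equations at the walls.  Let delta0 d be the difference in direction d,
replaced by 0 at points on the two walls orthogonal to d.  With delta0 the
electric equations hold at boundary points as well, where every term is zero
([half_step_closed]); the operators delta0 commute ([delta0_comm]) and keep the
boundary condition ([delta0_vanish]).  So delta0 w maps a solution to a solution of the same scheme
on the grid whose w-indices are exchanged, and the argument above applies
verbatim.

It remains to recognize the norms.  A difference across the outermost cell in
direction w of a function that vanishes on the wall is, up to sign, its value on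
the layer next to the wall divided by the step.  The near-boundary norms are
exactly these missing cells ([wall_layers]), so that the sum of both norms is the
full norm of delta0 w ([normE2_full], [normH2_full], [norms_energy]). *)

(** * Directions, points and indices *)

Definition eq_dir (d d' : dir) : bool :=
  match d, d' with
  | dx, dx | dy, dy | dz, dz => true
  | _, _ => false
  end.

Lemma eq_dirP : Equality.axiom eq_dir.
Proof. by case=> [] [] /=; constructor. Qed.

HB.instance Definition _ := hasDecEq.Build dir eq_dirP.

Definition dirs : seq dir := [:: dx; dy; dz].

Definition nxt (d : dir) : dir := match d with dx => dy | dy => dz | dz => dx end.
Definition prv (d : dir) : dir := match d with dx => dz | dy => dx | dz => dy end.

Definition pt (T : Type) (a b c : T) (d : dir) : T :=
  match d with dx => a | dy => b | dz => c end.

Definition upd (T : Type) (p : dir -> T) (d : dir) (t : T) (d' : dir) : T :=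
  if d' == d then t else p d'.

Definition val_at (R : Type) (u : scalar_grid_fun R) (p : dir -> int) : R :=
  u (p dx) (p dy) (p dz).

Lemma updE (T : Type) (p : dir -> T) d t : upd p d t d = t.
Proof. by rewrite /upd eqxx. Qed.

Lemma updN (T : Type) (p : dir -> T) d t d' : d' != d -> upd p d t d' = p d'.
Proof. by rewrite /upd => /negPf ->. Qed.

Lemma val_updd (R : Type) (u : scalar_grid_fun R) p d t t' :
  val_at u (upd (upd p d t) d t') = val_at u (upd p d t').
Proof. by case: d. Qed.

Lemma val_upd_pt (R : Type) (u : scalar_grid_fun R) p d t :
  val_at u (upd (pt (p dx) (p dy) (p dz)) d t) = val_at u (upd p d t).
Proof. by case: d. Qed.

Lemma val_line (R : realFieldType) (F : scalar_grid_fun R) d (s : seq int) p :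
  val_at (fun a b c => \sum_(t <- s) val_at F (upd (pt a b c) d t)) p
  = \sum_(t <- s) val_at F (upd p d t).
Proof. by apply: eq_bigr => t _; rewrite val_upd_pt. Qed.

Lemma node_add1 l : node l + 1 = mid l.
Proof. by rewrite /node /mid; lia. Qed.

Lemma mid_add1 l : mid l + 1 = node l.+1.
Proof. by rewrite /node /mid; lia. Qed.

Lemma mid_sub1 l : mid l - 1 = node l.
Proof. by rewrite /node /mid; lia. Qed.

Lemma nodeS_sub1 l : node l.+1 - 1 = mid l.
Proof. by rewrite /node /mid; lia. Qed.

Lemma mem_nodes l1 l2 t :
  reflect (exists2 l, (l1 <= l < l2)%N & t = node l) (t \in nodes l1 l2).
Proof.
apply: (iffP mapP) => [[l]|[l hl ->]].
  by rewrite mem_index_iota => hl ->; exists l.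
by exists l => //; rewrite mem_index_iota.
Qed.

Lemma mem_mids l1 l2 t :
  reflect (exists2 l, (l1 <= l < l2)%N & t = mid l) (t \in mids l1 l2).
Proof.
apply: (iffP mapP) => [[l]|[l hl ->]].
  by rewrite mem_index_iota => hl ->; exists l.
by exists l => //; rewrite mem_index_iota.
Qed.

(** * Sums over boxes of grid points *)

Definition gsum (R : realFieldType) (r : dir -> seq int) (F : scalar_grid_fun R) : R :=
  \sum_(a <- r dx) \sum_(b <- r dy) \sum_(c <- r dz) F a b c.

Section GridSums.
Variable R : realFieldType.
Implicit Types (r : dir -> seq int) (F G : scalar_grid_fun R) (p : dir -> int).

Lemma eq_gsum r F G :
  (forall p, (forall d, p d \in r d) -> val_at F p = val_at G p) ->
  gsum r F = gsum r G.
Proof.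
move=> eqFG; apply: eq_big_seq => a ra; apply: eq_big_seq => b rb.
by apply: eq_big_seq => c rc; apply: (eqFG (pt a b c)); case.
Qed.

Lemma eq_gsum_range r r' F : r =1 r' -> gsum r F = gsum r' F.
Proof. by move=> eqr; rewrite /gsum !eqr. Qed.

Lemma gsumD r F G :
  gsum r F + gsum r G = gsum r (fun a b c => F a b c + G a b c).
Proof.
rewrite /gsum -big_split; apply: eq_bigr => a _ /=.
rewrite -big_split; apply: eq_bigr => b _ /=.
by rewrite -big_split.
Qed.

Lemma gsumZ r k F : k * gsum r F = gsum r (fun a b c => k * F a b c).
Proof.
rewrite /gsum mulr_sumr; apply: eq_bigr => a _; rewrite mulr_sumr.
by apply: eq_bigr => b _; rewrite mulr_sumr.
Qed.

(** Makes the direction d innermost, so that each identity below is an identity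
for sums along a line.  The dummy range [:: 0] keeps the base point of the line
a triple; its entry is overwritten by t. *)
Lemma gsum_line r d F :
  gsum r F = gsum (upd r d [:: 0])
    (fun a b c => \sum_(t <- r d) val_at F (upd (pt a b c) d t)).
Proof.
case: d; rewrite /gsum /val_at /upd /=.
- rewrite big_seq1 exchange_big; apply: eq_bigr => b _ /=.
  by rewrite exchange_big.
- by apply: eq_bigr => a _; rewrite big_seq1 exchange_big.
- by apply: eq_bigr => a _; apply: eq_bigr => b _; rewrite big_seq1.
Qed.

End GridSums.

(** * The difference that is zero on the walls *)

Section Grid.
Variables (R : realFieldType) (g : mesh).
Implicit Types (k : dir -> bool) (p : dir -> int) (u v : scalar_grid_fun R).

(** The flag m tells whether the indices are half-integers.  Accordingly a
staggered grid is given by k : dir -> bool, with one flag k d per direction. *)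
Definition open_range (m : bool) (d : dir) : seq int :=
  if m then mids 0 (ncells g d) else nodes 1 (ncells g d).

Definition closed_range (m : bool) (d : dir) : seq int :=
  if m then mids 0 (ncells g d) else nodes 0 (ncells g d).+1.

Definition on_grid k p : Prop := forall d, p d \in closed_range (k d) d.

Definition interior k p : Prop := forall d, p d \in open_range (k d) d.

Definition wall p d : bool := (p d == node 0) || (p d == node (ncells g d)).

Definition vanish k u : Prop :=
  forall p, on_grid k p -> forall d, wall p d -> val_at u p = 0.

(** A difference in direction w maps functions on the grid k to functions on an
adjacent grid k'. *)
Definition adjacent (w : dir) k k' : Prop := forall d, k' d = k d (+) (d == w).

(** This differs from [delta] only where the w-index is an integer, that is, for
differences of functions with half-integer w-index; extending such a function
evenly across the wall would give the value 0. *)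
Definition delta0 (w : dir) u : scalar_grid_fun R :=
  fun a b c => if wall (pt a b c) w then 0 else delta g w u a b c.

Lemma adjacent_sym w k k' : adjacent w k k' -> adjacent w k' k.
Proof. by move=> h d; rewrite h addbK. Qed.

Lemma mid_not_wall p d : p d \in mids 0 (ncells g d) -> ~~ wall p d.
Proof.
case/mem_mids=> l _ e; rewrite /wall e /node /mid.
by apply/negP=> /orP[] /eqP; lia.
Qed.

Lemma interiorP m p d :
  (p d \in open_range m d) = (p d \in closed_range m d) && ~~ wall p d.
Proof.
case: m => /=.
  apply/idP/andP => [h|[]//]; split=> //; exact: mid_not_wall.
rewrite /wall; apply/idP/andP => [/mem_nodes[l hl ->]|[/mem_nodes[l hl ->] hw]].
  split; first by apply/mem_nodes; exists l => //; lia.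
  by rewrite /node; apply/negP=> /orP[] /eqP; lia.
apply/mem_nodes; exists l => //; move: hw; rewrite negb_or => /andP[/eqP h0 /eqP h1].
suff : (l <> 0 /\ l <> ncells g d)%N by lia.
by split=> e; [apply: h0 | apply: h1]; rewrite e.
Qed.

Lemma interior_on_grid k p : interior k p -> on_grid k p.
Proof. by move=> h d; have := h d; rewrite interiorP => /andP[]. Qed.

Lemma wall_upd p d t d' : d' != d -> wall (upd p d t) d' = wall p d'.
Proof. by move=> h; rewrite /wall updN. Qed.

Lemma val_delta w u p :
  val_at (delta g w u) p =
  (val_at u (upd p w (p w + 1)) - val_at u (upd p w (p w - 1))) / step R g w.
Proof. by case: w. Qed.

Lemma val_delta0 w u p :
  val_at (delta0 w u) p = if wall p w then 0 else val_at (delta g w u) p.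
Proof. by case: w. Qed.

Lemma neighbours w k k' p : adjacent w k k' -> on_grid k' p -> ~~ wall p w ->
  on_grid k (upd p w (p w + 1)) /\ on_grid k (upd p w (p w - 1)).
Proof.
move=> adj gp hw.
have : p w \in open_range (~~ k w) w.
  by rewrite interiorP hw andbT; have := gp w; rewrite adj eqxx addbT.
move=> pw; split=> d; have [->|dw] := eqVneq d w; rewrite ?updE ?updN //;
  try (by have := gp d; rewrite adj (negPf dw) addbF);
  move: pw; case: (k w) => /=.
- by case/mem_nodes=> l hl ->; rewrite node_add1; apply/mem_mids; exists l; lia.
- by case/mem_mids=> l hl ->; rewrite mid_add1; apply/mem_nodes; exists l.+1; lia.
- case/mem_nodes=> [[|l]] hl ->; first by lia.
  by rewrite nodeS_sub1; apply/mem_mids; exists l; lia.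
- by case/mem_mids=> l hl ->; rewrite mid_sub1; apply/mem_nodes; exists l; lia.
Qed.

(** On a wall orthogonal to w the value is 0 by definition.  On any other wall
both neighbours in direction w lie on the same wall. *)
Lemma delta0_vanish w k k' u : adjacent w k k' -> vanish k u -> vanish k' (delta0 w u).
Proof.
move=> adj hu p gp d hd; rewrite val_delta0.
case: ifPn => // hw; have [g1 g2] := neighbours adj gp hw.
have dw : d != w by apply: contraNneq hw => <-.
by rewrite val_delta (hu _ g1 d) ?(hu _ g2 d) ?wall_upd // subrr mul0r.
Qed.

(** Replacing values by 0 does not interfere with commutation: a step in direction
d' does not change whether a point is on a wall orthogonal to d. *)
Lemma delta0_comm d d' u p :
  val_at (delta0 d (delta0 d' u)) p = val_at (delta0 d' (delta0 d u)) p.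
Proof.
have [->//|dd'] := eqVneq d d'.
have d'd : d' != d by rewrite eq_sym.
rewrite !val_delta0 !val_delta !val_delta0 !wall_upd //.
case: (wall p d); case: (wall p d') => //=; rewrite ?subrr ?mul0r // !val_delta.
by case: d dd' d'd; case: d' => // _ _; rewrite /val_at /upd /=; ring.
Qed.

Definition dot k u v : R :=
  gsum (fun d => open_range (k d) d) (fun a b c => u a b c * v a b c).

Lemma dotC k u v : dot k u v = dot k v u.
Proof. by apply: eq_gsum => p _; rewrite /val_at mulrC. Qed.

Lemma eq_dot k u u' v v' :
  (forall p, interior k p -> val_at u p = val_at u' p) ->
  (forall p, interior k p -> val_at v p = val_at v' p) ->
  dot k u v = dot k u' v'.
Proof.
by move=> hu hv; apply: eq_gsum => p hp; have := hu p hp; have := hv p hp;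
  rewrite /val_at => -> ->.
Qed.

(** Abel summation, with the boundary terms removed by u. *)
Lemma sum_by_parts_1d (L : nat) (u v : int -> R) (h : R) :
  (0 < L)%N -> u (node 0) = 0 -> u (node L) = 0 ->
  \sum_(t <- nodes 1 L) u t * ((v (t + 1) - v (t - 1)) / h)
  + \sum_(t <- mids 0 L) (u (t + 1) - u (t - 1)) / h * v t = 0.
Proof.
case: L => // L _ u0 uL; rewrite /nodes /mids !big_map.
have -> : forall L, \sum_(1 <= l < L.+1) u (node l) *
     ((v (node l + 1) - v (node l - 1)) / h)
  + \sum_(0 <= l < L.+1) (u (mid l + 1) - u (mid l - 1)) / h * v (mid l)
  = (u (node L.+1) * v (mid L)) / h.
  elim=> [|M IH].
    by rewrite big_geq // big_nat1 mid_add1 mid_sub1 u0; ring.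
  rewrite big_nat_recr //= [X in _ + X]big_nat_recr //=.
  rewrite addrACA IH node_add1 nodeS_sub1 mid_add1 mid_sub1; ring.
by rewrite uL !mul0r.
Qed.

(** Exactly one of the two adjacent grids has integer indices in direction w, and
only the boundary condition of the function on that grid is needed to drop the
boundary terms; the statement is symmetric so that it serves both cases. *)
Lemma delta0_skew w k k' u v : (forall d, 0 < ncells g d)%N ->
  adjacent w k k' -> vanish k u -> vanish k' v ->
  dot k u (delta0 w v) + dot k' (delta0 w u) v = 0.
Proof.
move=> Lgt0.
(* k has the integer indices in direction w, so u provides the zero end values. *)
wlog kw : k k' u v / k w = false.
  case E : (k w); last by apply.
  move=> hwlog adj hu hv; rewrite addrC dotC [X in _ + X]dotC.
  apply: hwlog => //; first by rewrite adj E eqxx.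
  exact: adjacent_sym.
move=> adj hu hv; rewrite /dot (gsum_line _ w) [X in _ + X](gsum_line _ w).
rewrite -(@eq_gsum_range _ (upd (fun d => open_range (k d) d) w [:: 0])); last first.
  move=> d; rewrite /upd; case: eqP => // /eqP dw.
  by rewrite adj (negPf dw) addbF.
rewrite gsumD.
rewrite (@eq_gsum _ _ _ (fun _ _ _ => 0)); last first.
  move=> p hp; rewrite {1}/val_at adj kw eqxx /=.
  have gp t : t \in nodes 0 (ncells g w).+1 -> on_grid k (upd p w t).
    move=> ht d; have [->|dw] := eqVneq d w; first by rewrite updE kw.
    have := hp d; rewrite !updN // => hd.
    by have := interiorP (k d) p d; rewrite hd => /esym/andP[].
  have u0 : val_at u (upd p w (node 0)) = 0.
    apply: (hu _ (gp _ _) w); last by rewrite /wall updE eqxx.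
    by apply/mem_nodes; exists 0%N.
  have uL : val_at u (upd p w (node (ncells g w))) = 0.
    apply: (hu _ (gp _ _) w); last by rewrite /wall updE eqxx orbT.
    by apply/mem_nodes; exists (ncells g w) => //; rewrite ltnS leqnn.
  rewrite -[RHS](@sum_by_parts_1d _ (fun t => val_at u (upd p w t))
    (fun t => val_at v (upd p w t)) (step R g w) (Lgt0 w) u0 uL).
  congr (_ + _); apply: eq_big_seq => t ht; rewrite val_upd_pt {1}/val_at;
    rewrite -/(val_at u _) -/(val_at v _) -/(val_at (delta0 w _) _) val_delta0.
  - rewrite ifN ?val_delta ?updE ?val_updd //.
    have : upd p w t w \in open_range false w by rewrite updE.
    by rewrite interiorP => /andP[].
  - rewrite ifN ?val_delta ?updE ?val_updd //.
    by apply: mid_not_wall; rewrite updE.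
by rewrite /gsum big1 // => a _; rewrite big1 // => b _; rewrite big1.
Qed.

(** * Staggered vector fields and the energy of a half step *)

Implicit Types (s : dir -> bool) (U V : vector_grid_fun R).

(** The grids of the component c of an electric and of a magnetic field.  The flag
s d exchanges integer and half-integer indices in direction d: xpred0 is the
original grid and pred1 w the one on which w-differences live. *)
Definition halfE s (c d : dir) : bool := (d == c) (+) s d.
Definition halfH s (c d : dir) : bool := (d != c) (+) s d.

Definition delta1h0 U : vector_grid_fun R := fun c => delta0 (nxt c) (U (prv c)).
Definition delta2h0 U : vector_grid_fun R := fun c => delta0 (prv c) (U (nxt c)).
Definition vdelta0 w U : vector_grid_fun R := fun c => delta0 w (U c).

Definition vdot (k : dir -> dir -> bool) U V : R :=
  \sum_(c <- dirs) dot (k c) (U c) (V c).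

Definition vvanish (k : dir -> dir -> bool) U : Prop := forall c, vanish (k c) (U c).

Lemma half_nxtH s c : adjacent (nxt c) (halfE s (prv c)) (halfH s c).
Proof. by case: c => -[]; rewrite /halfE /halfH /=; case: (s _). Qed.

Lemma half_prvH s c : adjacent (prv c) (halfE s (nxt c)) (halfH s c).
Proof. by case: c => -[]; rewrite /halfE /halfH /=; case: (s _). Qed.

Lemma half_nxtE s c : adjacent (nxt c) (halfH s (prv c)) (halfE s c).
Proof. by case: c => -[]; rewrite /halfE /halfH /=; case: (s _). Qed.

Lemma half_prvE s c : adjacent (prv c) (halfH s (nxt c)) (halfE s c).
Proof. by case: c => -[]; rewrite /halfE /halfH /=; case: (s _). Qed.

Lemma halfE_flip w c : adjacent w (halfE xpred0 c) (halfE (pred1 w) c).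
Proof. by move=> d; rewrite /halfE /= addbF. Qed.

Lemma halfH_flip w c : adjacent w (halfH xpred0 c) (halfH (pred1 w) c).
Proof. by move=> d; rewrite /halfH /= addbF. Qed.

(** Each product of an electric component with a difference of a magnetic one
cancels against the product with the difference moved to the other factor. *)
Lemma delta1h0_skew s (e h : vector_grid_fun R) : (forall d, 0 < ncells g d)%N ->
  vvanish (halfE s) e -> vvanish (halfH s) h ->
  vdot (halfE s) e (delta1h0 h) + vdot (halfH s) h (delta2h0 e) = 0.
Proof.
move=> Lgt0 he hh.
have sk c : dot (halfE s c) (e c) (delta0 (nxt c) (h (prv c)))
          + dot (halfH s (prv c)) (h (prv c)) (delta0 (nxt c) (e c)) = 0.
  rewrite [X in _ + X]dotC; apply: delta0_skew => //.
  exact: adjacent_sym (half_nxtE s c).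
have sum3 (x y z x' y' z' : R) : x + z' = 0 -> y + x' = 0 -> z + y' = 0 ->
  x + (y + (z + 0)) + (x' + (y' + (z' + 0))) = 0 by lra.
rewrite /vdot /dirs !big_cons !big_nil; apply: sum3.
- exact: (sk dx).
- exact: (sk dy).
- exact: (sk dz).
Qed.

Lemma delta2h0_skew s (e h : vector_grid_fun R) : (forall d, 0 < ncells g d)%N ->
  vvanish (halfE s) e -> vvanish (halfH s) h ->
  vdot (halfE s) e (delta2h0 h) + vdot (halfH s) h (delta1h0 e) = 0.
Proof.
move=> Lgt0 he hh.
have sk c : dot (halfE s c) (e c) (delta0 (prv c) (h (nxt c)))
          + dot (halfH s (nxt c)) (h (nxt c)) (delta0 (prv c) (e c)) = 0.
  rewrite [X in _ + X]dotC; apply: delta0_skew => //.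
  exact: adjacent_sym (half_prvE s c).
have sum3 (x y z x' y' z' : R) : x + y' = 0 -> y + z' = 0 -> z + x' = 0 ->
  x + (y + (z + 0)) + (x' + (y' + (z' + 0))) = 0 by lra.
rewrite /vdot /dirs !big_cons !big_nil; apply: sum3.
- exact: (sk dx).
- exact: (sk dy).
- exact: (sk dz).
Qed.

(** The norm of u - a p, expanded: this is how squaring an equation of the
scheme is expressed. *)
Lemma dot_shift k a (u p u' p' : scalar_grid_fun R) :
  (forall x, interior k x ->
     val_at u x - a * val_at p x = val_at u' x - a * val_at p' x) ->
  dot k u u - 2 * a * dot k u p + a ^+ 2 * dot k p p
  = dot k u' u' - 2 * a * dot k u' p' + a ^+ 2 * dot k p' p'.
Proof.
have sq (f q : scalar_grid_fun R) :
    dot k f f - 2 * a * dot k f q + a ^+ 2 * dot k q q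
    = gsum (fun d => open_range (k d) d) (fun x y z => (f x y z - a * q x y z) ^+ 2).
  rewrite -mulNr /dot !gsumZ !gsumD; apply: eq_gsum => x _.
  by rewrite /val_at; ring.
move=> eq; rewrite !sq; apply: eq_gsum => x hx.
by have := eq x hx; rewrite /val_at => ->.
Qed.

Lemma vdot_shift (k : dir -> dir -> bool) a (U P U' P' : vector_grid_fun R) :
  (forall c x, interior (k c) x ->
     val_at (U c) x - a * val_at (P c) x = val_at (U' c) x - a * val_at (P' c) x) ->
  vdot k U U - 2 * a * vdot k U P + a ^+ 2 * vdot k P P
  = vdot k U' U' - 2 * a * vdot k U' P' + a ^+ 2 * vdot k P' P'.
Proof.
move=> eq; rewrite /vdot !mulr_sumr -!sumrB -!big_split /=.
by apply: eq_bigr => c _; apply: dot_shift (eq c).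
Qed.

(** The first stage, on the grid s.  The second stage is the same relation for
- a and - b, with (e0, h0) the fields at the later time. *)
Definition half_step0 s (a b : R) (e0 h0 e1 h1 : vector_grid_fun R) : Prop :=
  (forall c p, on_grid (halfE s c) p ->
     val_at (e1 c) p - a * val_at (delta1h0 h1 c) p
     = val_at (e0 c) p - a * val_at (delta2h0 h0 c) p) /\
  (forall c p, on_grid (halfH s c) p ->
     val_at (h1 c) p - b * val_at (delta2h0 e1 c) p
     = val_at (h0 c) p - b * val_at (delta1h0 e0 c) p).

(** The differences f of h and q of e are separate arguments, because one end of a
stage pairs delta1h h with delta2h e and the other end delta2h h with
delta1h e. *)
Definition energy s (eps mu a b : R) (e h f q : vector_grid_fun R) : R :=
  eps * (vdot (halfE s) e e + a ^+ 2 * vdot (halfE s) f f)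
  + mu * (vdot (halfH s) h h + b ^+ 2 * vdot (halfH s) q q).

(** Both equations are squared and summed; eps a = mu b makes the mixed products
combine into the sums that vanish by skew-symmetry. *)
Lemma half_step0_energy s eps mu a b (e0 h0 e1 h1 : vector_grid_fun R) :
  (forall d, 0 < ncells g d)%N -> eps * a = mu * b ->
  vvanish (halfE s) e0 -> vvanish (halfH s) h0 ->
  vvanish (halfE s) e1 -> vvanish (halfH s) h1 ->
  half_step0 s a b e0 h0 e1 h1 ->
  energy s eps mu a b e1 h1 (delta1h0 h1) (delta2h0 e1)
  = energy s eps mu a b e0 h0 (delta2h0 h0) (delta1h0 e0).
Proof.
move=> Lgt0 ab ve0 vh0 ve1 vh1 [hE hH].
have sqE := vdot_shift (fun c x hx => hE c x (interior_on_grid hx)).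
have sqH := vdot_shift (fun c x hx => hH c x (interior_on_grid hx)).
have sk1 := delta1h0_skew Lgt0 ve1 vh1; have sk0 := delta2h0_skew Lgt0 ve0 vh0.
have c1 : eps * (2 * a * vdot (halfE s) e1 (delta1h0 h1))
        + mu * (2 * b * vdot (halfH s) h1 (delta2h0 e1)) = 0.
  transitivity (2 * (eps * a) * (vdot (halfE s) e1 (delta1h0 h1)
                                 + vdot (halfH s) h1 (delta2h0 e1))).
    by rewrite mulrDr {2}ab; ring.
  by rewrite sk1 mulr0.
have c0 : eps * (2 * a * vdot (halfE s) e0 (delta2h0 h0))
        + mu * (2 * b * vdot (halfH s) h0 (delta1h0 e0)) = 0.
  transitivity (2 * (eps * a) * (vdot (halfE s) e0 (delta2h0 h0)
                                 + vdot (halfH s) h0 (delta1h0 e0))).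
    by rewrite mulrDr {2}ab; ring.
  by rewrite sk0 mulr0.
have combine (x1 y1 z1 x0 y0 z0 u1 v1 w1 u0 v0 w0 : R) :
    x1 - 2 * a * y1 + a ^+ 2 * z1 = x0 - 2 * a * y0 + a ^+ 2 * z0 ->
    u1 - 2 * b * v1 + b ^+ 2 * w1 = u0 - 2 * b * v0 + b ^+ 2 * w0 ->
    eps * (2 * a * y1) + mu * (2 * b * v1) = 0 ->
    eps * (2 * a * y0) + mu * (2 * b * v0) = 0 ->
    eps * (x1 + a ^+ 2 * z1) + mu * (u1 + b ^+ 2 * w1)
    = eps * (x0 + a ^+ 2 * z0) + mu * (u0 + b ^+ 2 * w0).
  move=> sq sq' cross1 cross0.
  transitivity (eps * (x1 - 2 * a * y1 + a ^+ 2 * z1)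
    + mu * (u1 - 2 * b * v1 + b ^+ 2 * w1)
    + (eps * (2 * a * y1) + mu * (2 * b * v1))); first by ring.
  by rewrite sq sq' cross1 -cross0; ring.
exact: combine sqE sqH c1 c0.
Qed.

Lemma delta0_balance w k k' a (u1 v1 u0 v0 : scalar_grid_fun R) : adjacent w k k' ->
  (forall p, on_grid k p ->
     val_at u1 p - a * val_at v1 p = val_at u0 p - a * val_at v0 p) ->
  forall p, on_grid k' p ->
     val_at (delta0 w u1) p - a * val_at (delta0 w v1) p
     = val_at (delta0 w u0) p - a * val_at (delta0 w v0) p.
Proof.
move=> adj eq p gp; rewrite !val_delta0; case: ifPn => // hw.
have [/eq e1 /eq e2] := neighbours adj gp hw.
have lin (u v : scalar_grid_fun R) :
    val_at (delta g w u) p - a * val_at (delta g w v) p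
    = ((val_at u (upd p w (p w + 1)) - a * val_at v (upd p w (p w + 1)))
       - (val_at u (upd p w (p w - 1)) - a * val_at v (upd p w (p w - 1))))
      / step R g w.
  by rewrite !val_delta; ring.
by rewrite !lin e1 e2.
Qed.

(** The equations are linear, hold up to the walls, and only involve differences
that commute with the one in direction w. *)
Lemma half_step0_vdelta0 w a b (e0 h0 e1 h1 : vector_grid_fun R) :
  half_step0 xpred0 a b e0 h0 e1 h1 ->
  half_step0 (pred1 w) a b (vdelta0 w e0) (vdelta0 w h0) (vdelta0 w e1) (vdelta0 w h1).
Proof.
case=> hE hH; split=> c p gp; rewrite /delta1h0 /delta2h0 /vdelta0;
  rewrite (delta0_comm (nxt c) w) (delta0_comm (prv c) w).
- exact: (delta0_balance (@halfE_flip w c) (hE c)).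
- exact: (delta0_balance (@halfH_flip w c) (hH c)).
Qed.

(** * The norms, with their near-boundary parts *)

Definition sq u : scalar_grid_fun R := fun a b c => u a b c ^+ 2.

Lemma val_sq u p : val_at (sq u) p = val_at u p ^+ 2.
Proof. by []. Qed.

Lemma mids_layers L : (1 < L)%N -> mids 0 L = mid 0 :: mids 1 L.-1 ++ [:: mid L.-1].
Proof.
case: L => [|[|L]] // _; rewrite /mids /index_iota subn0 subn1 /=; congr cons.
by rewrite -[RHS](map_cat mid _ (iota (1 + L) 1)) -iotaD addn1.
Qed.

Lemma nodes_layers L : (0 < L)%N -> nodes 0 L.+1 = node 0 :: nodes 1 L ++ [:: node L].
Proof.
case: L => [|L] // _; rewrite /nodes /index_iota subn0 subn1 /=; congr cons.
by rewrite -[RHS](map_cat node _ (iota (1 + L) 1)) -iotaD addn1.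
Qed.

(** The cells next to the two walls have one node on the wall, where u is zero, so
the difference across them is the value at the other node over the step.  For
two cells both near-boundary nodes coincide, and the node counts once for each
cell. *)
Lemma wall_layers w (r : dir -> seq int) u : (1 < ncells g w)%N ->
  (forall p, (forall d, d != w -> p d \in r d) -> wall p w -> val_at u p = 0) ->
  gsum (upd r w (mids 0 (ncells g w))) (sq (delta0 w u))
  = gsum (upd r w (mids 1 (ncells g w).-1)) (sq (delta g w u))
    + (step R g w) ^- 2 * gsum (upd r w (near_boundary (ncells g w))) (sq u).
Proof.
move=> Lgt1 hu; rewrite (gsum_line _ w) [X in _ = X + _](gsum_line _ w).
rewrite [X in _ = _ + _ * X](gsum_line _ w) !updE gsumZ.
have rE l : upd (upd r w l) w [:: 0] =1 upd r w [:: 0].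
  by move=> d; rewrite /upd; case: eqP.
rewrite !(eq_gsum_range _ (rE _)) gsumD; apply: eq_gsum => p hp.
have u_wall t : (t == node 0) || (t == node (ncells g w)) -> val_at u (upd p w t) = 0.
  move=> ht; apply: hu; last by rewrite /wall updE.
  by move=> d dw; have := hp d; rewrite !updN.
have delta0E t : t \in mids 0 (ncells g w) ->
    val_at (delta0 w u) (upd p w t)
    = (val_at u (upd p w (t + 1)) - val_at u (upd p w (t - 1))) / step R g w.
  move=> ht; rewrite val_delta0 ifN ?val_delta ?updE ?val_updd //.
  by apply: mid_not_wall; rewrite updE.
suff line : \sum_(t <- mids 0 (ncells g w)) val_at (sq (delta0 w u)) (upd p w t)
    = \sum_(t <- mids 1 (ncells g w).-1) val_at (sq (delta g w u)) (upd p w t)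
      + step R g w ^- 2
        * \sum_(t <- near_boundary (ncells g w)) val_at (sq u) (upd p w t).
  by move: line; rewrite -!val_line.
rewrite mids_layers // big_cons big_cat big_seq1 /near_boundary !big_cons big_nil /=.
have -> : \sum_(t <- mids 1 (ncells g w).-1) val_at (sq (delta0 w u)) (upd p w t)
    = \sum_(t <- mids 1 (ncells g w).-1) val_at (sq (delta g w u)) (upd p w t).
  apply: eq_big_seq => t /mem_mids[l hl ->]; rewrite !val_sq val_delta0 ifN //.
  by apply: mid_not_wall; rewrite updE; apply/mem_mids; exists l => //; lia.
rewrite !val_sq !delta0E; first last.
- by apply/mem_mids; exists 0%N => //; lia.
- by apply/mem_mids; exists (ncells g w).-1 => //; lia.
rewrite !mid_add1 !mid_sub1 prednK ?(ltnW Lgt1) //.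
rewrite (u_wall (node 0)) ?eqxx // (u_wall (node (ncells g w))) ?eqxx ?orbT //.
rewrite -exprVn; ring.
Qed.


Lemma gsum_closed d (r : dir -> seq int) (F : scalar_grid_fun R) :
  (0 < ncells g d)%N ->
  (forall p, (forall d', d' != d -> p d' \in r d') ->
     p d \in nodes 0 (ncells g d).+1 -> wall p d -> val_at F p = 0) ->
  gsum (upd r d (nodes 0 (ncells g d).+1)) F
  = gsum (upd r d (nodes 1 (ncells g d))) F.
Proof.
move=> Lgt0 hF; rewrite (gsum_line _ d) [RHS](gsum_line _ d) !updE.
have rE l : upd (upd r d l) d [:: 0] =1 upd r d [:: 0].
  by move=> d'; rewrite /upd; case: eqP.
rewrite !(eq_gsum_range _ (rE _)); apply: eq_gsum => p hp; rewrite !val_line.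
have F0 t : t \in nodes 0 (ncells g d).+1 ->
    (t == node 0) || (t == node (ncells g d)) -> val_at F (upd p d t) = 0.
  move=> ht wt; apply: hF; rewrite /wall ?updE //.
  by move=> d' dd'; have := hp d'; rewrite !updN.
move: F0; rewrite nodes_layers // => F0.
rewrite big_cons big_cat big_seq1 /= !F0 ?eqxx ?orbT //.
- by rewrite add0r addr0.
by rewrite inE mem_cat !inE eqxx !orbT.
Qed.

(** The summation ranges in direction d, for the component c: [rangeE] and [rangeH]
in the norms of w-differences, [nearE] and [nearH] in the near-boundary norms. *)
Definition rangeE (w c d : dir) : seq int :=
  if d == w then
    if c == w then nodes 1 (ncells g w) else mids 1 (ncells g w).-1
  else open_range (d == c) d.

Definition rangeH (w c d : dir) : seq int :=
  if d == w then
    if c == w then mids 1 (ncells g w).-1 else nodes 1 (ncells g w)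
  else closed_range (d != c) d.

Definition nearE (w c d : dir) : seq int :=
  if d == w then near_boundary (ncells g w) else open_range (d == c) d.

Definition nearH (w c d : dir) : seq int :=
  if d == w then near_boundary (ncells g w) else closed_range (d != c) d.

Lemma dot_sq k u : dot k u u = gsum (fun d => open_range (k d) d) (sq u).
Proof. by apply: eq_gsum => p _; rewrite /val_at /sq expr2. Qed.

(** For c = w the differences sit at interior nodes and there is no contribution
from the walls; the other components are zero on the walls orthogonal to w. *)
Lemma dot_rangeE w c u : (forall d, 1 < ncells g d)%N ->
  vanish (halfE xpred0 c) u ->
  dot (halfE (pred1 w) c) (delta0 w u) (delta0 w u)
  = gsum (rangeE w c) (sq (delta g w u))
    + (if c == w then 0 else step R g w ^- 2 * gsum (nearE w c) (sq u)).
Proof.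
move=> Lgt1 hu; rewrite dot_sq; case: eqVneq => [->|cw].
  rewrite addr0; transitivity (gsum (rangeE w w) (sq (delta0 w u))).
    apply: eq_gsum_range => d; rewrite /rangeE /halfE /= eqxx.
    by case: eqP => [->|_] //=; rewrite addbF.
  apply: eq_gsum => p /(_ w); rewrite /rangeE !eqxx => hp.
  rewrite !val_sq val_delta0 ifN //.
  by have := interiorP false p w; rewrite hp => /esym/andP[].
pose r d := open_range (d == c) d.
transitivity (gsum (upd r w (mids 0 (ncells g w))) (sq (delta0 w u))).
  apply: eq_gsum_range => d; rewrite /halfE /upd /r /=.
  by case: (eqVneq d w) => [->|]; rewrite ?addbF // eq_sym (negPf cw).
rewrite wall_layers //; last first.
  move=> p hp pw; apply: (hu p _ w pw) => d.
  rewrite /halfE addbF; have [->|dw] := eqVneq d w.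
    rewrite eq_sym (negPf cw); apply/mem_nodes.
    by case/orP: pw => /eqP ->; [exists 0%N | exists (ncells g w)];
      rewrite ?ltnS ?leqnn.
  by have := interiorP (d == c) p d; rewrite hp // => /esym/andP[].
by rewrite /rangeE (negPf cw).
Qed.

(** The roles of the components are exchanged with respect to the electric case.
In addition the ranges of the components c other than w include the two walls
orthogonal to c, where the difference in direction w is zero. *)
Lemma dot_rangeH w c v : (forall d, 1 < ncells g d)%N ->
  vanish (halfH xpred0 c) v ->
  dot (halfH (pred1 w) c) (delta0 w v) (delta0 w v)
  = gsum (rangeH w c) (sq (delta g w v))
    + (if c == w then step R g w ^- 2 * gsum (nearH w c) (sq v) else 0).
Proof.
move=> Lgt1 hv; rewrite dot_sq; case: eqVneq => [->|cw] in hv *.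
  pose r d := closed_range (d != w) d.
  transitivity (gsum (upd r w (mids 0 (ncells g w))) (sq (delta0 w v))).
    apply: eq_gsum_range => d; rewrite /halfH /upd /r /=.
    by case: (eqVneq d w) => [->|].
  rewrite wall_layers //; last first.
    move=> p hp pw; apply: (hv p _ w pw) => d.
    rewrite /halfH addbF; have [->|dw] := eqVneq d w.
      apply/mem_nodes.
      by case/orP: pw => /eqP ->; [exists 0%N | exists (ncells g w)];
        rewrite ?ltnS ?leqnn.
    by have := hp d dw; rewrite /r dw.
  by rewrite /rangeH eqxx.
rewrite addr0; transitivity (gsum (rangeH w c) (sq (delta0 w v))); last first.
  apply: eq_gsum => p /(_ w); rewrite /rangeH eqxx (negPf cw) => hp.
  rewrite !val_sq val_delta0 ifN //.
  by have := interiorP false p w; rewrite hp => /esym/andP[].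
have wc : w != c by rewrite eq_sym.
transitivity (gsum (upd (rangeH w c) c (nodes 0 (ncells g c).+1)) (sq (delta0 w v)));
  last first.
  apply: eq_gsum_range => d; rewrite /upd /rangeH.
  by case: (eqVneq d c) => [->|//]; rewrite (negPf cw).
rewrite gsum_closed ?(ltnW (Lgt1 c)) //; last first.
  move=> p hp pc pw; rewrite val_sq (delta0_vanish (halfH_flip w c) hv _ pw) ?expr0n //.
  move=> d; rewrite /halfH /=; have [->|dc] := eqVneq d c.
    by rewrite (negPf cw).
  have := hp d dc; rewrite /rangeH dc (negPf cw); case: eqVneq => [->|] //.
  by move=> h; have := interiorP false p w; rewrite h => /esym/andP[].
apply: eq_gsum_range => d; rewrite /upd /rangeH /halfH /=.
case: (eqVneq d c) => [->|dc] /=; first by rewrite (negPf cw).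
case: (eqVneq d w) => [->|dw] //=; first by rewrite (negPf cw).
Qed.

Lemma step_neq0 d : (0 < ncells g d)%N -> step R g d != 0.
Proof. by move=> Lgt0; rewrite /step mul1r invr_neq0 // pnatr_eq0 -lt0n. Qed.

Lemma normE2_deltaE w P U :
  normE2_delta g w P U
  = cell_volume R g * P * \sum_(c <- dirs) gsum (rangeE w c) (sq (delta g w (U c))).
Proof.
rewrite /normE2_delta /rangeE /open_range /dirs !big_cons big_nil addr0.
by case: g => I J K; case: w; rewrite addrA.
Qed.

Lemma normH2_deltaE w P V :
  normH2_delta g w P V
  = cell_volume R g * P * \sum_(c <- dirs) gsum (rangeH w c) (sq (delta g w (V c))).
Proof.
rewrite /normH2_delta /rangeH /closed_range /dirs !big_cons big_nil addr0.
by case: g => I J K; case: w; rewrite addrA.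
Qed.

Lemma normLE2E w P U : (forall d, 0 < ncells g d)%N ->
  normLE2 g w P U
  = cell_volume R g * P * \sum_(c <- dirs)
      (if c == w then 0 else step R g w ^- 2 * gsum (nearE w c) (sq (U c))).
Proof.
move=> Lgt0; rewrite /normLE2 /nearE /open_range /dirs !big_cons big_nil addr0.
rewrite /cell_volume.
have := step_neq0 (Lgt0 dx); have := step_neq0 (Lgt0 dy); have := step_neq0 (Lgt0 dz).
case: g => I J K; case: w;
  move: (step R _ dx) (step R _ dy) (step R _ dz) => hx hy hz nz ny nx;
  by rewrite /gsum /sumsq /sq /=; field.
Qed.

Lemma normLH2E w P V : (forall d, 0 < ncells g d)%N ->
  normLH2 g w P V
  = cell_volume R g * P * \sum_(c <- dirs)
      (if c == w then step R g w ^- 2 * gsum (nearH w c) (sq (V c)) else 0).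
Proof.
move=> Lgt0; rewrite /normLH2 /nearH /closed_range /dirs !big_cons big_nil addr0.
rewrite /cell_volume.
have := step_neq0 (Lgt0 dx); have := step_neq0 (Lgt0 dy); have := step_neq0 (Lgt0 dz).
case: g => I J K; case: w;
  move: (step R _ dx) (step R _ dy) (step R _ dz) => hx hy hz nz ny nx;
  by rewrite /gsum /sumsq /sq /=; field.
Qed.

Lemma normE2_full w P U : (forall d, 1 < ncells g d)%N -> vvanish (halfE xpred0) U ->
  normE2_delta g w P U + normLE2 g w P U
  = cell_volume R g * P * vdot (halfE (pred1 w)) (vdelta0 w U) (vdelta0 w U).
Proof.
move=> Lgt1 hU; rewrite normE2_deltaE normLE2E => [|d]; last exact: ltnW.
rewrite -mulrDr -big_split /=; congr (_ * _).
by apply: eq_bigr => c _; rewrite dot_rangeE.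
Qed.

Lemma normH2_full w P V : (forall d, 1 < ncells g d)%N -> vvanish (halfH xpred0) V ->
  normH2_delta g w P V + normLH2 g w P V
  = cell_volume R g * P * vdot (halfH (pred1 w)) (vdelta0 w V) (vdelta0 w V).
Proof.
move=> Lgt1 hV; rewrite normH2_deltaE normLH2E => [|d]; last exact: ltnW.
rewrite -mulrDr -big_split /=; congr (_ * _).
by apply: eq_bigr => c _; rewrite dot_rangeH.
Qed.

(** The norms only read values at interior points of the electric grid; this
allows [delta2h] to be replaced by the version that is zero on the walls. *)
Lemma eq_normE2_full w P U V : (forall d, 1 < ncells g d)%N ->
  (forall c p, interior (halfE xpred0 c) p -> val_at (U c) p = val_at (V c) p) ->
  normE2_delta g w P U + normLE2 g w P U = normE2_delta g w P V + normLE2 g w P V.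
Proof.
move=> Lgt1 eqUV; have Lgt0 d : (0 < ncells g d)%N by exact: ltnW.
have Lw := Lgt1 w.
rewrite !normE2_deltaE !normLE2E //; congr (_ * _ + _ * _).
- apply: eq_bigr => c _; apply: eq_gsum => p hp; rewrite !val_sq !val_delta.
  suff [e1 e2] : interior (halfE xpred0 c) (upd p w (p w + 1)) /\
                 interior (halfE xpred0 c) (upd p w (p w - 1)).
    by rewrite (eqUV _ _ e1) (eqUV _ _ e2).
  split=> d; have := hp d; rewrite /rangeE /halfE addbF /upd; case: eqVneq => // ->;
    rewrite eq_sym; case: eqVneq => //= _.
  + by case/mem_nodes=> l hl ->; rewrite node_add1; apply/mem_mids; exists l; lia.
  + by case/mem_mids=> l hl ->; rewrite mid_add1; apply/mem_nodes; exists l.+1; lia.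
  + case/mem_nodes=> [[|l]] hl ->; first by lia.
    by rewrite nodeS_sub1; apply/mem_mids; exists l; lia.
  + by case/mem_mids=> l hl ->; rewrite mid_sub1; apply/mem_nodes; exists l; lia.
- apply: eq_bigr => c _; case: eqVneq => // cw; congr (_ * _).
  apply: eq_gsum => p hp; rewrite !val_sq eqUV // => d.
  have := hp d; rewrite /nearE /halfE addbF; case: eqVneq => // ->.
  rewrite eq_sym (negPf cw) => pw.
  have : (p w == node 1) || (p w == node (ncells g w).-1).
    by move: pw; rewrite !inE.
  case/orP=> /eqP ->; apply/mem_nodes; first by exists 1%N.
  by exists (ncells g w).-1 => //; lia.
Qed.

Lemma eq_normH2_full w P U V : (forall d, 1 < ncells g d)%N ->
  (forall c p, on_grid (halfH xpred0 c) p -> val_at (U c) p = val_at (V c) p) ->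
  normH2_delta g w P U + normLH2 g w P U = normH2_delta g w P V + normLH2 g w P V.
Proof.
move=> Lgt1 eqUV; have Lgt0 d : (0 < ncells g d)%N by exact: ltnW.
have Lw := Lgt1 w.
rewrite !normH2_deltaE !normLH2E //; congr (_ * _ + _ * _).
- apply: eq_bigr => c _; apply: eq_gsum => p hp; rewrite !val_sq !val_delta.
  suff [e1 e2] : on_grid (halfH xpred0 c) (upd p w (p w + 1)) /\
                 on_grid (halfH xpred0 c) (upd p w (p w - 1)).
    by rewrite (eqUV _ _ e1) (eqUV _ _ e2).
  split=> d; have := hp d; rewrite /rangeH /halfH addbF /upd; case: eqVneq => // ->;
    rewrite eq_sym; case: eqVneq => //= _.
  + by case/mem_mids=> l hl ->; rewrite mid_add1; apply/mem_nodes; exists l.+1; lia.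
  + by case/mem_nodes=> l hl ->; rewrite node_add1; apply/mem_mids; exists l; lia.
  + by case/mem_mids=> l hl ->; rewrite mid_sub1; apply/mem_nodes; exists l; lia.
  + case/mem_nodes=> [[|l]] hl ->; first by lia.
    by rewrite nodeS_sub1; apply/mem_mids; exists l; lia.
- apply: eq_bigr => c _; case: eqVneq => // cw; congr (_ * _).
  apply: eq_gsum => p hp; rewrite !val_sq eqUV // => d.
  have := hp d; rewrite /nearH /halfH addbF; case: eqVneq => // ->.
  rewrite cw eqxx => pw; have : (p w == node 1) || (p w == node (ncells g w).-1).
    by move: pw; rewrite !inE.
  case/orP=> /eqP ->; apply/mem_nodes; first by exists 1%N => //; lia.
  by exists (ncells g w).-1 => //; lia.
Qed.

(** * From the scheme to equations up to the walls *)

Lemma delta1hE U c p : ~~ wall p (nxt c) ->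
  val_at (delta1h g U c) p = val_at (delta1h0 U c) p.
Proof. by move=> hp; rewrite val_delta0 ifN //; case: c hp. Qed.

Lemma delta2hE U c p : ~~ wall p (prv c) ->
  val_at (delta2h g U c) p = val_at (delta2h0 U c) p.
Proof. by move=> hp; rewrite val_delta0 ifN //; case: c hp. Qed.

Lemma interior_not_wall k p d : interior k p -> ~~ wall p d.
Proof. by move=> /(_ d); rewrite interiorP => /andP[]. Qed.

Lemma halfH_not_wall c p d : on_grid (halfH xpred0 c) p -> d != c -> ~~ wall p d.
Proof.
move=> /(_ d) + dc; rewrite /halfH dc /=; exact: mid_not_wall.
Qed.

Lemma nxt_neq c : nxt c != c. Proof. by case: c. Qed.
Lemma prv_neq c : prv c != c. Proof. by case: c. Qed.

Lemma delta1h0_vanishE s h : vvanish (halfH s) h -> vvanish (halfE s) (delta1h0 h).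
Proof. by move=> hh c; apply: delta0_vanish (hh (prv c)); apply: half_nxtE. Qed.

Lemma delta2h0_vanishE s h : vvanish (halfH s) h -> vvanish (halfE s) (delta2h0 h).
Proof. by move=> hh c; apply: delta0_vanish (hh (nxt c)); apply: half_prvE. Qed.

Lemma delta1h0_vanishH s e : vvanish (halfE s) e -> vvanish (halfH s) (delta1h0 e).
Proof. by move=> he c; apply: delta0_vanish (he (prv c)); apply: half_nxtH. Qed.

Lemma delta2h0_vanishH s e : vvanish (halfE s) e -> vvanish (halfH s) (delta2h0 e).
Proof. by move=> he c; apply: delta0_vanish (he (nxt c)); apply: half_prvH. Qed.

(** The equations where the scheme imposes them: at interior electric points and
at all magnetic points, with the plain differences. *)
Definition half_step (a b : R) (e0 h0 e1 h1 : vector_grid_fun R) : Prop :=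
  (forall c p, interior (halfE xpred0 c) p ->
     val_at (e1 c) p - a * val_at (delta1h g h1 c) p
     = val_at (e0 c) p - a * val_at (delta2h g h0 c) p) /\
  (forall c p, on_grid (halfH xpred0 c) p ->
     val_at (h1 c) p - b * val_at (delta2h g e1 c) p
     = val_at (h0 c) p - b * val_at (delta1h g e0 c) p).

(** At magnetic points the differences in the scheme are never across a wall.  At
an electric point on a wall, every term vanishes. *)
Lemma half_step_closed a b (e0 h0 e1 h1 : vector_grid_fun R) :
  vvanish (halfE xpred0) e0 -> vvanish (halfH xpred0) h0 ->
  vvanish (halfE xpred0) e1 -> vvanish (halfH xpred0) h1 ->
  half_step a b e0 h0 e1 h1 -> half_step0 xpred0 a b e0 h0 e1 h1.
Proof.
move=> ve0 vh0 ve1 vh1 [hE hH]; split=> c p gp; last first.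
  have nw := halfH_not_wall gp.
  by rewrite -delta1hE ?nw ?nxt_neq // -delta2hE ?nw ?prv_neq //; exact: hH.
have [/hasP[d _ pw]|nw] := boolP (has (wall p) dirs).
  by rewrite (ve0 c p gp d pw) (ve1 c p gp d pw) (delta1h0_vanishE vh1 gp pw)
     (delta2h0_vanishE vh0 gp pw).
have nwd d : ~~ wall p d.
  by apply: contra nw => pd; apply/hasP; exists d => //; case: (d).
rewrite -delta1hE // -delta2hE //; apply: hE => d.
by rewrite interiorP nwd andbT; exact: gp.
Qed.

(** The equation for the normal magnetic component on a wall only contains
differences along the wall of tangential electric components. *)
Lemma half_step_wall a b (e0 h0 e1 h1 : vector_grid_fun R) :
  vvanish (halfE xpred0) e0 -> vvanish (halfE xpred0) e1 ->
  half_step a b e0 h0 e1 h1 ->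
  forall c p d, on_grid (halfH xpred0 c) p -> wall p d ->
  val_at (h1 c) p = val_at (h0 c) p.
Proof.
move=> ve0 ve1 [_ hH] c p d gp pw; have := hH c p gp.
have nw := halfH_not_wall gp.
rewrite delta1hE ?nw ?nxt_neq // delta2hE ?nw ?prv_neq //.
by rewrite (delta1h0_vanishH ve0 gp pw) (delta2h0_vanishH ve1 gp pw) mulr0 !subr0.
Qed.

Definition diff (dt : R) U V : vector_grid_fun R :=
  fun c x y z => (U c x y z - V c x y z) / dt.

Lemma half_step_diff dt a b (e0 h0 e1 h1 e0' h0' e1' h1' : vector_grid_fun R) :
  half_step a b e0 h0 e1 h1 -> half_step a b e0' h0' e1' h1' ->
  half_step a b (diff dt e0 e0') (diff dt h0 h0') (diff dt e1 e1') (diff dt h1 h1').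
Proof.
have lin1 U V c p : val_at (delta1h g (diff dt U V) c) p
    = (val_at (delta1h g U c) p - val_at (delta1h g V c) p) / dt.
  by case: c; rewrite /= /val_at /delta /diff; ring.
have lin2 U V c p : val_at (delta2h g (diff dt U V) c) p
    = (val_at (delta2h g U c) p - val_at (delta2h g V c) p) / dt.
  by case: c; rewrite /= /val_at /delta /diff; ring.
have lin0 U V c p : val_at (diff dt U V c) p = (val_at (U c) p - val_at (V c) p) / dt.
  by [].
have comb (k x y x' y' : R) :
  (x - y) / dt - k * ((x' - y') / dt) = ((x - k * x') - (y - k * y')) / dt by ring.
move=> [hE hH] [hE' hH']; split=> c p gp; rewrite lin1 lin2 !lin0 !comb.
  by rewrite hE // hE'.
by rewrite hH // hH'.
Qed.

Lemma vdot_delta2h0_vdelta0 w U :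
  vdot (halfE (pred1 w)) (vdelta0 w (delta2h0 U)) (vdelta0 w (delta2h0 U))
  = vdot (halfE (pred1 w)) (delta2h0 (vdelta0 w U)) (delta2h0 (vdelta0 w U)).
Proof. by apply: eq_bigr => c _; apply: eq_dot => p _; exact: delta0_comm. Qed.

Lemma vdot_delta1h0_vdelta0 w U :
  vdot (halfH (pred1 w)) (vdelta0 w (delta1h0 U)) (vdelta0 w (delta1h0 U))
  = vdot (halfH (pred1 w)) (delta1h0 (vdelta0 w U)) (delta1h0 (vdelta0 w U)).
Proof. by apply: eq_bigr => c _; apply: eq_dot => p _; exact: delta0_comm. Qed.

(** Each of the two sides of the conservation law is an energy of the w-difference:
the near-boundary norms complete the norms of w-differences, and the factor
dt^2 / (4 mu eps) splits as eps a^2 = mu (dt^2 / (4 mu eps)) and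
mu b^2 = eps (dt^2 / (4 mu eps)). *)
Lemma norms_energy w (eps mu dt : R) e h : (forall d, 1 < ncells g d)%N ->
  eps != 0 -> mu != 0 ->
  vvanish (halfE xpred0) e -> vvanish (halfH xpred0) h ->
  normE2_delta g w eps e + normH2_delta g w mu h
  + dt ^+ 2 / (4 * mu * eps)
    * (normH2_delta g w eps (delta1h g e) + normE2_delta g w mu (delta2h g h))
  + normLE2 g w eps e + normLH2 g w mu h
  + dt ^+ 2 / (4 * mu * eps)
    * (normLE2 g w mu (delta2h g h) + normLH2 g w eps (delta1h g e))
  = cell_volume R g
    * energy (pred1 w) eps mu (dt / (2 * eps)) (dt / (2 * mu)) (vdelta0 w e)
        (vdelta0 w h) (delta2h0 (vdelta0 w h)) (delta1h0 (vdelta0 w e)).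
Proof.
move=> Lgt1 eps0 mu0 ve vh.
have NE := normE2_full w eps Lgt1 ve; have NH := normH2_full w mu Lgt1 vh.
have NdH : normE2_delta g w mu (delta2h g h) + normLE2 g w mu (delta2h g h)
    = cell_volume R g * mu
      * vdot (halfE (pred1 w)) (delta2h0 (vdelta0 w h)) (delta2h0 (vdelta0 w h)).
  rewrite -vdot_delta2h0_vdelta0 -normE2_full //; last exact: delta2h0_vanishE.
  by apply: eq_normE2_full => // c p hp; rewrite delta2hE // (interior_not_wall _ hp).
have NdE : normH2_delta g w eps (delta1h g e) + normLH2 g w eps (delta1h g e)
    = cell_volume R g * eps
      * vdot (halfH (pred1 w)) (delta1h0 (vdelta0 w e)) (delta1h0 (vdelta0 w e)).
  rewrite -vdot_delta1h0_vdelta0 -normH2_full //; last exact: delta1h0_vanishH.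
  apply: eq_normH2_full => // c p hp.
  by rewrite delta1hE // (halfH_not_wall hp) // nxt_neq.
have regroup (k x1 x2 x3 x4 y1 y2 y3 y4 : R) :
    x1 + x2 + k * (x3 + x4) + y1 + y2 + k * (y4 + y3)
    = (x1 + y1) + (x2 + y2) + k * ((x3 + y3) + (x4 + y4)) by ring.
rewrite regroup NE NH NdE NdH /energy.
set A := vdot _ (vdelta0 w e) _; set B := vdot _ (vdelta0 w h) _.
set C := vdot _ (delta1h0 _) _; set D := vdot _ (delta2h0 _) _.
move: (cell_volume R g) A B C D => v A B C D; field; by rewrite mu0.
Qed.

(** [interiorE_ind] and [on_gridH_ind] match the componentwise index conditions of
the scheme. *)
Lemma interiorE_ind (P : dir -> int -> int -> int -> Prop) :
  (forall i j k : nat, (i < Nx g)%N -> (0 < j < Ny g)%N -> (0 < k < Nz g)%N ->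
     P dx (mid i) (node j) (node k)) ->
  (forall i j k : nat, (0 < i < Nx g)%N -> (j < Ny g)%N -> (0 < k < Nz g)%N ->
     P dy (node i) (mid j) (node k)) ->
  (forall i j k : nat, (0 < i < Nx g)%N -> (0 < j < Ny g)%N -> (k < Nz g)%N ->
     P dz (node i) (node j) (mid k)) ->
  forall c p, interior (halfE xpred0 c) p -> P c (p dx) (p dy) (p dz).
Proof.
move=> Px Py Pz [] p hp.
- have /mem_mids[i hi ->] := hp dx; have /mem_nodes[j hj ->] := hp dy.
  by have /mem_nodes[k hk ->] := hp dz; exact: Px.
- have /mem_nodes[i hi ->] := hp dx; have /mem_mids[j hj ->] := hp dy.
  by have /mem_nodes[k hk ->] := hp dz; exact: Py.
- have /mem_nodes[i hi ->] := hp dx; have /mem_nodes[j hj ->] := hp dy.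
  by have /mem_mids[k hk ->] := hp dz; exact: Pz.
Qed.

Lemma on_gridH_ind (P : dir -> int -> int -> int -> Prop) :
  (forall i j k : nat, (i <= Nx g)%N -> (j < Ny g)%N -> (k < Nz g)%N ->
     P dx (node i) (mid j) (mid k)) ->
  (forall i j k : nat, (i < Nx g)%N -> (j <= Ny g)%N -> (k < Nz g)%N ->
     P dy (mid i) (node j) (mid k)) ->
  (forall i j k : nat, (i < Nx g)%N -> (j < Ny g)%N -> (k <= Nz g)%N ->
     P dz (mid i) (mid j) (node k)) ->
  forall c p, on_grid (halfH xpred0 c) p -> P c (p dx) (p dy) (p dz).
Proof.
move=> Px Py Pz [] p hp.
- have /mem_nodes[i hi ->] := hp dx; have /mem_mids[j hj ->] := hp dy.
  by have /mem_mids[k hk ->] := hp dz; exact: Px.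
- have /mem_mids[i hi ->] := hp dx; have /mem_nodes[j hj ->] := hp dy.
  by have /mem_mids[k hk ->] := hp dz; exact: Py.
- have /mem_mids[i hi ->] := hp dx; have /mem_mids[j hj ->] := hp dy.
  by have /mem_nodes[k hk ->] := hp dz; exact: Pz.
Qed.

Lemma adi_stage1_half_step (eps mu dt : R) (E H : evolution R) n :
  eps != 0 -> mu != 0 -> dt != 0 -> adi_stage1 g eps mu dt E H n ->
  half_step (dt / (2 * eps)) (dt / (2 * mu)) (E (node n)) (H (node n))
    (E (mid n)) (H (mid n)).
Proof.
move=> eps0 mu0 dt0 [[Ex Ey Ez] [Hx Hy Hz]].
have clear_dt (k X Y f q : R) : k != 0 ->
    (X - Y) / dt = 1 / (2 * k) * (f - q) ->
    X - dt / (2 * k) * f = Y - dt / (2 * k) * q.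
  move=> k0 /(congr1 ( *%R^~ dt)); rewrite divfK // => eqXY.
  have -> : X = Y + (X - Y) by ring.
  by rewrite eqXY; field.
split.
  apply: (@interiorE_ind (fun c x y z =>
      E (mid n) c x y z - dt / (2 * eps) * delta1h g (H (mid n)) c x y z
      = E (node n) c x y z - dt / (2 * eps) * delta2h g (H (node n)) c x y z))
    => i j k hi hj hk; apply: clear_dt => //; [exact: Ex | exact: Ey | exact: Ez].
apply: (@on_gridH_ind (fun c x y z =>
    H (mid n) c x y z - dt / (2 * mu) * delta2h g (E (mid n)) c x y z
    = H (node n) c x y z - dt / (2 * mu) * delta1h g (E (node n)) c x y z))
  => i j k hi hj hk; apply: clear_dt => //; [exact: Hx | exact: Hy | exact: Hz].
Qed.

(** In the second stage the differences at the half level are those of the first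
stage with the opposite sign, so it is a half step that starts at the later
time and has negative coefficients. *)
Lemma adi_stage2_half_step (eps mu dt : R) (E H : evolution R) n :
  eps != 0 -> mu != 0 -> dt != 0 -> adi_stage2 g eps mu dt E H n ->
  half_step (- (dt / (2 * eps))) (- (dt / (2 * mu))) (E (node n.+1)) (H (node n.+1))
    (E (mid n)) (H (mid n)).
Proof.
move=> eps0 mu0 dt0 [[Ex Ey Ez] [Hx Hy Hz]].
have clear_dt (k X Y f q : R) : k != 0 ->
    (X - Y) / dt = 1 / (2 * k) * (f - q) ->
    Y - - (dt / (2 * k)) * f = X - - (dt / (2 * k)) * q.
  move=> k0 /(congr1 ( *%R^~ dt)); rewrite divfK // => eqXY.
  have -> : X = Y + (X - Y) by ring.
  by rewrite eqXY; field.
split.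
  apply: (@interiorE_ind (fun c x y z =>
      E (mid n) c x y z - - (dt / (2 * eps)) * delta1h g (H (mid n)) c x y z
      = E (node n.+1) c x y z - - (dt / (2 * eps)) * delta2h g (H (node n.+1)) c x y z))
    => i j k hi hj hk; apply: clear_dt => //; [exact: Ex | exact: Ey | exact: Ez].
apply: (@on_gridH_ind (fun c x y z =>
    H (mid n) c x y z - - (dt / (2 * mu)) * delta2h g (E (mid n)) c x y z
    = H (node n.+1) c x y z - - (dt / (2 * mu)) * delta1h g (E (node n.+1)) c x y z))
  => i j k hi hj hk; apply: clear_dt => //; [exact: Hx | exact: Hy | exact: Hz].
Qed.

Lemma node_inj : injective node.
Proof. by move=> l l'; rewrite /node; lia. Qed.

Lemma pec_vanish U : pec_at g U -> vvanish (halfE xpred0) U.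
Proof.
case=> Ux Uy Uz [] p gp d pw.
- have /mem_mids[i hi ei] := gp dx; have /mem_nodes[j hj ej] := gp dy.
  have /mem_nodes[k hk ek] := gp dz.
  rewrite /val_at ei ej ek; apply: Ux => //.
  case: d pw => [|/orP[]|/orP[]].
  + by rewrite (negPf (mid_not_wall (gp dx))).
  + by rewrite ej => /eqP /node_inj ->; constructor 1.
  + by rewrite ej => /eqP /node_inj ->; constructor 2.
  + by rewrite ek => /eqP /node_inj ->; constructor 3.
  + by rewrite ek => /eqP /node_inj ->; constructor 4.
- have /mem_nodes[i hi ei] := gp dx; have /mem_mids[j hj ej] := gp dy.
  have /mem_nodes[k hk ek] := gp dz.
  rewrite /val_at ei ej ek; apply: Uy => //.
  case: d pw => [/orP[]| |/orP[]].
  + by rewrite ei => /eqP /node_inj ->; constructor 1.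
  + by rewrite ei => /eqP /node_inj ->; constructor 2.
  + by rewrite (negPf (mid_not_wall (gp dy))).
  + by rewrite ek => /eqP /node_inj ->; constructor 3.
  + by rewrite ek => /eqP /node_inj ->; constructor 4.
- have /mem_nodes[i hi ei] := gp dx; have /mem_nodes[j hj ej] := gp dy.
  have /mem_mids[k hk ek] := gp dz.
  rewrite /val_at ei ej ek; apply: Uz => //.
  case: d pw => [/orP[]|/orP[]|].
  + by rewrite ei => /eqP /node_inj ->; constructor 1.
  + by rewrite ei => /eqP /node_inj ->; constructor 2.
  + by rewrite ej => /eqP /node_inj ->; constructor 3.
  + by rewrite ej => /eqP /node_inj ->; constructor 4.
  + by rewrite (negPf (mid_not_wall (gp dz))).
Qed.

Lemma diff_vanish (k : dir -> dir -> bool) (dt : R) U V :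
  (forall c p d, on_grid (k c) p -> wall p d -> val_at (U c) p = val_at (V c) p) ->
  vvanish k (diff dt U V).
Proof.
move=> eqUV c p gp d pw; have := eqUV c p d gp pw.
by rewrite /val_at /diff => ->; rewrite subrr mul0r.
Qed.

End Grid.

(** * Conservation over one time step *)

Lemma delta_t_mid (R : realFieldType) (dt : R) (U : evolution R) n :
  delta_t dt U (mid n) = diff dt (U (node n.+1)) (U (node n)).
Proof. by rewrite /delta_t mid_add1 mid_sub1. Qed.

Theorem theorem3p3 (R : realFieldType) (I J K N : nat) (eps mu T : R)
    (E H : evolution R) (n : nat) (w : dir)
    (hI : (2 <= I)%N) (hJ : (2 <= J)%N) (hK : (2 <= K)%N) (hN : (1 <= N)%N)
    (heps : 0 < eps) (hmu : 0 < mu) (hT : 0 < T)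
    (hn1 : (1 <= n)%N) (hnN : (n <= N - 1)%N)
    (hscheme : adi_fdtd (Mesh I J K) eps mu (T / N%:R) N E H)
    (hpec : pec (Mesh I J K) N E) :
  let g := Mesh I J K in
  let dt := T / N%:R in
  let dtE := delta_t dt E in
  let dtH := delta_t dt H in
  normE2_delta g w eps (dtE (mid n)) + normH2_delta g w mu (dtH (mid n))
  + dt ^+ 2 / (4 * mu * eps)
    * (normH2_delta g w eps (delta1h g (dtE (mid n)))
       + normE2_delta g w mu (delta2h g (dtH (mid n))))
  + normLE2 g w eps (dtE (mid n)) + normLH2 g w mu (dtH (mid n))
  + dt ^+ 2 / (4 * mu * eps)
    * (normLE2 g w mu (delta2h g (dtH (mid n)))
       + normLH2 g w eps (delta1h g (dtE (mid n))))
  =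
  normE2_delta g w eps (dtE (mid (n - 1))) + normH2_delta g w mu (dtH (mid (n - 1)))
  + dt ^+ 2 / (4 * mu * eps)
    * (normH2_delta g w eps (delta1h g (dtE (mid (n - 1))))
       + normE2_delta g w mu (delta2h g (dtH (mid (n - 1)))))
  + normLE2 g w eps (dtE (mid (n - 1))) + normLH2 g w mu (dtH (mid (n - 1)))
  + dt ^+ 2 / (4 * mu * eps)
    * (normLE2 g w mu (delta2h g (dtH (mid (n - 1))))
       + normLH2 g w eps (delta1h g (dtE (mid (n - 1))))).
Proof.
case: n => [|n] // in hn1 hnN *.
move=> g dt dtE dtH; rewrite /dtE /dtH subSS subn0 !delta_t_mid.
set a := dt / (2 * eps); set b := dt / (2 * mu).
have eps0 : eps != 0 by rewrite gt_eqF.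
have mu0 : mu != 0 by rewrite gt_eqF.
have dt0 : dt != 0 by rewrite mulf_neq0 ?gt_eqF // invr_gt0 ltr0n.
have Lgt1 d : (1 < ncells g d)%N by case: d.
have Lgt0 d : (0 < ncells g d)%N by exact: ltnW.
have [s1 s2] : adi_stage1 g eps mu dt E H n.+1 /\ adi_stage2 g eps mu dt E H n.+1.
  by apply: hscheme; lia.
have [s1' s2'] : adi_stage1 g eps mu dt E H n /\ adi_stage2 g eps mu dt E H n.
  by apply: hscheme; lia.
have vE m : (m <= N.*2)%N -> vvanish g (halfE xpred0) (E m%:Z).
  by move=> hm; apply: pec_vanish; exact: hpec.
have E2 : vvanish g (halfE xpred0) (E (node n.+2)) by apply: vE; lia.
have E1 : vvanish g (halfE xpred0) (E (mid n.+1)) by apply: vE; lia.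
have E0 : vvanish g (halfE xpred0) (E (node n.+1)) by apply: vE; lia.
have E1' : vvanish g (halfE xpred0) (E (mid n)) by apply: vE; lia.
have E0' : vvanish g (halfE xpred0) (E (node n)) by apply: vE; lia.
have r1 := adi_stage1_half_step eps0 mu0 dt0 s1.
have r2 := adi_stage2_half_step eps0 mu0 dt0 s2.
have r1' := adi_stage1_half_step eps0 mu0 dt0 s1'.
have r2' := adi_stage2_half_step eps0 mu0 dt0 s2'.
have w1 := half_step_wall E0 E1 r1; have w2 := half_step_wall E2 E1 r2.
have w1' := half_step_wall E0' E1' r1'; have w2' := half_step_wall E0 E1' r2'.
have ve U V : vvanish g (halfE xpred0) U -> vvanish g (halfE xpred0) V ->
    vvanish g (halfE xpred0) (diff dt U V).
  move=> hU hV; apply: diff_vanish => c p d gp pw.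
  by rewrite (hU c p gp d) ?(hV c p gp d).
(* On a wall the normal magnetic field is carried unchanged through the stages
   linking the two time levels of each difference. *)
have vh2 : vvanish g (halfH xpred0) (diff dt (H (node n.+2)) (H (node n.+1))).
  by apply: diff_vanish => c p d gp pw; rewrite -(w2 c p d) // (w1 c p d).
have vh1 : vvanish g (halfH xpred0) (diff dt (H (mid n.+1)) (H (mid n))).
  by apply: diff_vanish => c p d gp pw; rewrite (w1 c p d) // (w2' c p d).
have vh0 : vvanish g (halfH xpred0) (diff dt (H (node n.+1)) (H (node n))).
  by apply: diff_vanish => c p d gp pw; rewrite -(w2' c p d) // (w1' c p d).
have ve2 := ve _ _ E2 E0; have ve1 := ve _ _ E1 E1'; have ve0 := ve _ _ E0 E0'.
have /half_step0_vdelta0 - /(_ w) step1 :=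
  half_step_closed ve0 vh0 ve1 vh1 (half_step_diff dt r1 r1').
have /half_step0_vdelta0 - /(_ w) step2 :=
  half_step_closed ve2 vh2 ve1 vh1 (half_step_diff dt r2 r2').
have vE_delta0 (U : vector_grid_fun R) : vvanish g (halfE xpred0) U ->
    vvanish g (halfE (pred1 w)) (vdelta0 g w U).
  by move=> hU c; apply: delta0_vanish (hU c); exact: halfE_flip.
have vH_delta0 (U : vector_grid_fun R) : vvanish g (halfH xpred0) U ->
    vvanish g (halfH (pred1 w)) (vdelta0 g w U).
  by move=> hU c; apply: delta0_vanish (hU c); exact: halfH_flip.
have ab : eps * a = mu * b by rewrite /a /b; field; rewrite ?eps0 ?mu0.
have abN : eps * - a = mu * - b by rewrite !mulrN ab.
rewrite !norms_energy //; congr (_ * _).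
(* The first stage ends, and the second one read backwards ends as well, at the
   half time level, and the opposite signs of a and b are squared away. *)
rewrite -(half_step0_energy Lgt0 ab (vE_delta0 _ ve0) (vH_delta0 _ vh0)
  (vE_delta0 _ ve1) (vH_delta0 _ vh1) step1).
have := half_step0_energy Lgt0 abN (vE_delta0 _ ve2) (vH_delta0 _ vh2)
  (vE_delta0 _ ve1) (vH_delta0 _ vh1) step2.
by rewrite /energy !sqrrN => ->.
Qed.
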